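(* Let $\mathcal G\in\mathbb A^{p,q}$ be any admissible mesh and let $\mathcal M\subseteq\mathcal G$ be any set of marked elements. Then $\operatorname{ref}^{p,q}(\mathcal G,\mathcal M)\in\mathbb A^{p,q}$.
   Context: Fix integers $p,q\ge 2$ (polynomial degrees) and positive integers $M,N$. Initial mesh: $\mathcal G_0=\{[m-1,m]\times[n-1,n]\mid 1\le m\le M,\ 1\le n\le N\}$, and $\overline\Omega=\bigcup\mathcal G_0=[0,M]\times[0,N]$. Elements are closed axis-parallel rectangles; a mesh is a set of elements obtained from $\mathcal G_0$ by bisections as defined below. Level: $\ell(K)=-\log_2|K|$, where $|K|$ is the area of $K$. Distance: for elements $K_1,K_2$, $\operatorname{Dist}(K_1,K_2)\in\mathbb R^2$ is the componentwise absolute value of $\operatorname{mid}(K_1)-\operatorname{mid}(K_2)$, where $\operatorname{mid}$ denotes the midpoint. Inequalities between vectors are componentwise. Patch: $\mathcal G^{p,q}(K)=\{K'\in\mathcal G\mid \operatorname{Dist}(K',K)\le \mathbf D^{p,q}(\ell(K))\}$, where $\mathbf D^{p,q}(k)=2^{-k/2}\bigl(\lfloor p/2\rfloor+\tfrac12,\ \lceil q/2\rceil+\tfrac12\bigr)$ if $k$ is even and $\mathbf D^{p,q}(k)=2^{-(k+1)/2}\bigl(\lceil p/2\rceil+\tfrac12,\ 2\lfloor q/2\rfloor+1\bigr)$ if $k$ is odd. Bisection: for $K=[\mu,\mu+\tilde\mu]\times[\nu,\nu+\tilde\nu]$, $\operatorname{child}(K)$ is the pair of rectangles obtained by halving $K$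 in the $x$-direction (i.e. cutting along $x=\mu+\tilde\mu/2$) if $\ell(K)$ is even, and by halving $K$ in the $y$-direction (cutting along $y=\nu+\tilde\nu/2$) if $\ell(K)$ is odd. For $K\in\mathcal G$, $\operatorname{bisect}(\mathcal G,K)=(\mathcal G\setminus\{K\})\cup\operatorname{child}(K)$; for $\mathcal M=\{K_1,\dots,K_J\}\subseteq\mathcal G$, $\operatorname{bisect}(\mathcal G,\mathcal M)$ is the result of successively bisecting $K_1,\dots,K_J$ (in arbitrary order). Admissibility: the bisection of $K\in\mathcal G$ is admissible if all $K'\in\mathcal G^{p,q}(K)$ satisfy $\ell(K')\ge\ell(K)$. The bisection $\operatorname{bisect}(\mathcal G,\mathcal M)$ of several elements is admissible if the elements of $\mathcal M$ can be ordered such that it is a concatenation of admissible bisections of single elements (each with respect to the current mesh). A mesh $\mathcal G$ is admissible if it is $\mathcal G_0$ or there are meshes $\mathcal G_1,\dots,\mathcal G_J=\mathcal G$ and sets $\mathcal M_j\subseteq\mathcal G_j$ such that $\mathcal G_{j+1}=\operatorname{bisect}(\mathcal G_j,\mathcal M_j)$ is an admissible bisection for $j=0,\dots,J-1$. $\mathbb A^{p,q}$ is the set of all admissible meshes. Closure and refinement: for $\mathcal M\subseteq\mathcal G$, $\operatorname{clos}^{p,q}_{\mathcal G}(\mathcal M)$ is the smallest set $\tilde{\mathcal M}$ with $\mathcal M\subseteq\tilde{\mathcal M}\subseteq\mathcal G$ such that for every $K\in\tilde{\mathcal M}$, all $K'\in\mathcal G^{p,q}(K)$ with $\ell(K')<\ell(K)$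 belong to $\tilde{\mathcal M}$ (computed by starting with $\mathcal M$ and repeatedly adding such $K'$ until the set stops growing). Then $\operatorname{ref}^{p,q}(\mathcal G,\mathcal M)=\operatorname{bisect}(\mathcal G,\operatorname{clos}^{p,q}_{\mathcal G}(\mathcal M))$. *)

(* Defs.v *)
From HB Require Import structures.
From mathcomp Require Import all_boot all_order all_algebra.
From mathcomp Require Import finmap.
From mathcomp Require Import boolp reals exp.

Set Implicit Arguments.
Unset Strict Implicit.
Unset Printing Implicit Defensive.

Import Order.TTheory GRing.Theory Num.Theory.
Local Open Scope fset_scope.
Local Open Scope ring_scope.

(* [Rect mu nu w h] is the closed rectangle [mu, mu + w] x [nu, nu + h].      *)
(* The encoding is injective on rectangles of positive width and height,      *)
(* which are the only ones occurring in the meshes below.                     *)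
Record rect (R : realType) := Rect {
  left : R;
  bottom : R;
  width : R;
  height : R }.

Definition rect_encode (R : realType) (K : rect R) : (R * R) * (R * R) :=
  ((left K, bottom K), (width K, height K)).

Definition rect_decode (R : realType) (u : (R * R) * (R * R)) : rect R :=
  Rect u.1.1 u.1.2 u.2.1 u.2.2.

Lemma rect_encodeK (R : realType) : cancel (@rect_encode R) (@rect_decode R).
Proof. by case. Qed.

HB.instance Definition _ (R : realType) :=
  Choice.copy (rect R) (can_type (@rect_encodeK R)).

Definition mesh (R : realType) := {fset rect R}.

Section Mesh.
Variable R : realType.
Implicit Types (K : rect R) (G M : mesh R) (s : seq (rect R)).

Definition initial_mesh (m n : nat) : mesh R :=
  [fset Rect (i%:R - 1) (j%:R - 1) 1 1 | i in iota 1 m, j in iota 1 n].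

Definition area K : R := width K * height K.

Definition level K : R := - (ln (area K) / ln 2).

(* Levels are real numbers that happen to be integers on all meshes obtained  *)
(* from [initial_mesh] by bisection; there, the negation of [even_level]      *)
(* means "odd".                                                               *)
Definition even_level (k : R) : bool := k / 2 \is a Num.int.

Definition mid K : R * R := (left K + width K / 2, bottom K + height K / 2).

Definition Dist K1 K2 : R * R :=
  (`|(mid K1).1 - (mid K2).1|, `|(mid K1).2 - (mid K2).2|).

Definition vle (u v : R * R) : bool := (u.1 <= v.1) && (u.2 <= v.2).

(* [n./2] and [uphalf n] are the floor and the ceiling of n / 2.              *)
Definition Dvec (p q : nat) (k : R) : R * R :=
  if even_level k then
    (2 `^ (- k / 2) * ((p./2)%:R + 1 / 2),
     2 `^ (- k / 2) * ((uphalf q)%:R + 1 / 2))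
  else
    (2 `^ (- (k + 1) / 2) * ((uphalf p)%:R + 1 / 2),
     2 `^ (- (k + 1) / 2) * (2 * (q./2)%:R + 1)).

Definition patch (p q : nat) G K : mesh R :=
  [fset K' in G | vle (Dist K' K) (Dvec p q (level K))].

Definition child K : mesh R :=
  if even_level (level K) then
    [fset Rect (left K) (bottom K) (width K / 2) (height K);
          Rect (left K + width K / 2) (bottom K) (width K / 2) (height K)]
  else
    [fset Rect (left K) (bottom K) (width K) (height K / 2);
          Rect (left K) (bottom K + height K / 2) (width K) (height K / 2)].

Definition bisect1 G K : mesh R := (G `\ K) `|` child K.

Definition bisect_seq G s : mesh R := foldl bisect1 G s.

(* The elements of a mesh do not overlap, so no element of a mesh is a child  *)
(* of another one and the order in which [M] is enumerated is immaterial.     *)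
Definition bisect G M : mesh R := bisect_seq G (enum_fset M).

Definition admissible_bisect1 (p q : nat) G K : Prop :=
  K \in G /\ forall K', K' \in patch p q G K -> level K <= level K'.

Fixpoint admissible_bisect_seq (p q : nat) G s : Prop :=
  if s is K :: s' then
    admissible_bisect1 p q G K /\ admissible_bisect_seq p q (bisect1 G K) s'
  else True.

Definition admissible_bisect (p q : nat) G M : Prop :=
  exists s, [/\ perm_eq s (enum_fset M),
                bisect_seq G s = bisect G M &
                admissible_bisect_seq p q G s].

Inductive admissible_mesh (p q m n : nat) : mesh R -> Prop :=
| admissible_initial : admissible_mesh p q m n (initial_mesh m n)
| admissible_step G M :
    admissible_mesh p q m n G -> M `<=` G -> admissible_bisect p q G M ->
    admissible_mesh p q m n (bisect G M).

Definition patch_closed (p q : nat) G M : Prop :=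
  forall K, K \in M ->
  forall K', K' \in patch p q G K -> level K' < level K -> K' \in M.

(* The smallest patch-closed set between [M] and [G], as the intersection of  *)
(* all of them; for [M `<=` G] the family is not empty, as it contains [G].   *)
Definition clos (p q : nat) G M : mesh R :=
  [fset K in G | `[< forall M' : mesh R, M `<=` M' -> M' `<=` G ->
                     patch_closed p q G M' -> K \in M' >]].

Definition refine (p q : nat) G M : mesh R := bisect G (clos p q G M).

End Mesh.

(* Main.v *)
(* Bisect the closure by increasing level. When the turn of K comes, a nearby *)
(* coarser element cannot be an unbisected element of G (the closure contains *)
(* it, so it has been bisected already), hence it is a child of some E in G   *)
(* that was bisected before. Passing from a cell to its parent enlarges the   *)
(* patch by at least the displacement of the midpoint, so climbing up the     *)
(* ancestors of K, one finds that E is near a strict ancestor A of K which is *)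
(* finer than E. But A was once bisected admissibly, and in an admissible     *)
(* mesh no element coarser than a previously bisected cell A is near A.       *)

Require Import Defs.
From mathcomp Require Import all_boot all_order all_algebra.
From mathcomp Require Import finmap.
From mathcomp Require Import reals.
From mathcomp Require Import boolp exp zify ring lra.

Set Implicit Arguments.
Unset Strict Implicit.
Unset Printing Implicit Defensive.

Import Order.TTheory GRing.Theory Num.Theory.
Local Open Scope fset_scope.
Local Open Scope ring_scope.

(** Every cell arising in an admissible mesh is some [dyadic k a b], and nearness of two such cells
    is a pair of integer inequalities. A mesh [G] is studied together with the set [B] of cells
    bisected so far; the decisive invariant is [history_far]: no cell of [G] coarser than a cell of
    [B] is near it. The geometric lemmas [near_parent] and [near_parents], where [p, q >= 2] enters,
    yield [child_far]: a child of a mesh cell is never near a finer cell of [G] or [B]. This serves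
    twice: [history_bisect1] uses it to preserve the invariant, and [bisect_patch_closed] to bisect
    the closure in order of level. *)

Section Dyadic.
Variables (R : realType) (p q : nat).
Hypotheses (p_ge2 : (2 <= p)%N) (q_ge2 : (2 <= q)%N).
Implicit Types (K A E c : rect R) (G B C M : mesh R) (s : seq (rect R)).
Implicit Types (k a b j : nat).

(** The grid cells of level [k]: squares for even [k], half as wide as high for odd [k], because the
    first cut halves the width. *)
Definition dyadic k a b : rect R :=
  let w := 2^-1 ^+ uphalf k in let h := 2^-1 ^+ k./2 in
  Rect (a%:R * w) (b%:R * h) w h.

Definition is_dyadic k K := exists a b, K = dyadic k a b.

(** Membership in the patch of [K] without reference to a mesh, so that [K] may be a cell that has
    already been bisected. *)
Definition near K' K := vle (Dist K' K) (Dvec p q (level K)).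

Lemma level_dyadic k K : is_dyadic k K -> level K = k%:R.
Proof.
move=> [a [b ->]]; rewrite /level /area /= -exprD uphalf_half -addnA addnn.
rewrite odd_double_half lnXn ?invr_gt0// lnV ?posrE// mulNrn mulNr opprK.
by rewrite -[ln 2 *+ k]mulr_natl mulfK // gt_eqF // ln_gt0 // ltr1n.
Qed.

Lemma even_level_nat k : even_level (k%:R : R) = ~~ odd k.
Proof.
rewrite /even_level; apply/idP/idP => [/intrP[z hz]|ek].
  have : k%:Z = z * 2.
    by apply/eqP; rewrite -(eqr_int R) rmorphM /= -hz; apply/eqP; field.
  lia.
by rewrite -(even_halfK ek) -muln2 natrM mulfK ?pnatr_eq0 ?rpred_nat.
Qed.

Lemma powR2Nn (x : R) j : x = - j%:R -> 2 `^ x = 2^-1 ^+ j.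
Proof. by move=> ->; rewrite powRN powR_mulrn // exprVn. Qed.

Lemma Dvec_even j :
  Dvec p q (j.*2%:R : R) = (2^-1 ^+ j * (p./2%:R + 1 / 2),
                          2^-1 ^+ j * ((uphalf q)%:R + 1 / 2)).
Proof.
rewrite /Dvec even_level_nat odd_double /= (@powR2Nn _ j) //.
by rewrite -muln2 natrM; field.
Qed.

Lemma Dvec_odd j :
  Dvec p q (j.*2.+1%:R : R) = (2^-1 ^+ j.+1 * ((uphalf p)%:R + 1 / 2),
                          2^-1 ^+ j.+1 * (2 * q./2%:R + 1)).
Proof.
rewrite /Dvec even_level_nat /= odd_double /= (@powR2Nn _ j.+1) //.
by rewrite -natr1 -muln2 natrM; field.
Qed.


(** * Children and parents of dyadic cells *)

Lemma child_even_dyadic j a b c : c \in child (dyadic j.*2 a b) ->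
  exists e : bool, c = dyadic j.*2.+1 (a.*2 + e) b.
Proof.
have hw : (2^-1 ^+ j / 2 : R) = 2^-1 ^+ j.+1 by rewrite exprSr.
have e2 : (2^-1 ^+ j : R) = 2 * 2^-1 ^+ j.+1 by rewrite exprS; field.
rewrite /child (@level_dyadic j.*2); last by exists a, b.
rewrite even_level_nat odd_double /= !inE /dyadic /= !uphalf_double !doubleK.
rewrite ?doubleK hw => /orP[] /eqP ->; [exists false|exists true].
  by congr Rect; rewrite e2 addn0 -muln2 natrM; ring.
by congr Rect; rewrite e2 natrD -muln2 natrM mulr1n; ring.
Qed.

Lemma child_odd_dyadic j a b c : c \in child (dyadic j.*2.+1 a b) ->
  exists e : bool, c = dyadic j.+1.*2 a (b.*2 + e).
Proof.
have hw : (2^-1 ^+ j / 2 : R) = 2^-1 ^+ j.+1 by rewrite exprSr.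
have e2 : (2^-1 ^+ j : R) = 2 * 2^-1 ^+ j.+1 by rewrite exprS; field.
rewrite /child (@level_dyadic j.*2.+1); last by exists a, b.
rewrite even_level_nat /= odd_double /= !inE /dyadic /= !uphalf_double !doubleK.
rewrite ?doubleK hw => /orP[] /eqP ->; [exists false|exists true].
  by congr Rect; rewrite e2 addn0 -muln2 natrM; ring.
by congr Rect; rewrite e2 natrD -muln2 natrM mulr1n; ring.
Qed.

Variant parity_spec : nat -> Type :=
| ParityEven j : parity_spec j.*2
| ParityOdd j : parity_spec j.*2.+1.

Lemma parityP k : parity_spec k.
Proof. by rewrite -(odd_double_half k); case: (odd k); constructor. Qed.

Lemma dyadic_child k A c : is_dyadic k A -> c \in child A -> is_dyadic k.+1 c.
Proof.
move=> [a [b ->]]; case: (parityP k) => j.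
  by move=> /child_even_dyadic[e ->]; eexists _, _.
by move=> /child_odd_dyadic[e ->]; eexists _, _.
Qed.

Lemma dyadic_inj k a b a' b' :
  dyadic k a b = dyadic k a' b' -> a = a' /\ b = b'.
Proof.
have nz i : (2^-1 ^+ i : R) != 0 by rewrite expf_neq0 // invr_neq0 // pnatr_eq0.
case=> /(mulIf (nz _))/eqP + /(mulIf (nz _))/eqP; rewrite !eqr_nat.
by move=> /eqP-> /eqP->.
Qed.

Lemma is_dyadic_level_inj k k' K : is_dyadic k K -> is_dyadic k' K -> k = k'.
Proof.
move=> /level_dyadic lK /level_dyadic; rewrite lK => /eqP.
by rewrite eqr_nat => /eqP.
Qed.

(** The level of [c] gives that of its parent, and halving the index of [c] in the cut direction
    recovers the index of the parent. *)
Lemma dyadic_parent_unique k k' A A' c : is_dyadic k A -> is_dyadic k' A' ->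
  c \in child A -> c \in child A' -> A = A'.
Proof.
move=> dA dA' cA cA'.
have := is_dyadic_level_inj (dyadic_child dA cA) (dyadic_child dA' cA').
case=> ek; case: k' / ek dA' => dA'.
move: dA dA' cA cA' => [a [b ->]] [a' [b' ->]].
case: (parityP k) => j.
  move=> /child_even_dyadic[e ->] /child_even_dyadic[e' /dyadic_inj[ea ->]].
  by have -> : a = a' by lia.
move=> /child_odd_dyadic[e ->] /child_odd_dyadic[e' /dyadic_inj[-> eb]].
by have -> : b = b' by lia.
Qed.

(** * Nearness of cells and of their parents *)

Lemma near_even K j a b : near K (dyadic j.*2 a b) =
  (`|(mid K).1 - (a%:R + 1 / 2) * 2^-1 ^+ j| <= 2^-1 ^+ j * (p./2%:R + 1 / 2)) &&
  (`|(mid K).2 - (b%:R + 1 / 2) * 2^-1 ^+ j|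
     <= 2^-1 ^+ j * ((uphalf q)%:R + 1 / 2)).
Proof.
rewrite /near /vle (@level_dyadic j.*2); last by exists a, b.
rewrite Dvec_even /= uphalf_double doubleK.
by congr andb; congr (_ <= _); try (congr (`|_|)); ring.
Qed.

Lemma near_odd K j a b : near K (dyadic j.*2.+1 a b) =
  (`|(mid K).1 - (a%:R + 1 / 2) * 2^-1 ^+ j.+1|
     <= 2^-1 ^+ j.+1 * ((uphalf p)%:R + 1 / 2)) &&
  (`|(mid K).2 - (b%:R + 1 / 2) * 2^-1 ^+ j|
     <= 2^-1 ^+ j.+1 * (2 * q./2%:R + 1)).
Proof.
rewrite /near /vle (@level_dyadic j.*2.+1); last by exists a, b.
rewrite Dvec_odd /= uphalf_double doubleK.
by congr andb; congr (_ <= _); try (congr (`|_|)); ring.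
Qed.

(** In the cut direction the midpoint moves by a quarter of the parent's side; the larger patch of
    the parent absorbs this because [uphalf p <= 2 * p./2] for [p >= 2], and likewise for [q]. In
    the other direction floor against ceiling suffices. *)
Lemma near_parent k A c K : is_dyadic k A -> c \in child A ->
  near K c -> near K A.
Proof.
move=> [a [b ->]]; case: (parityP k) => j.
  move=> /child_even_dyadic[e ->]; rewrite near_even near_odd.
  move: (mid K) => [x y] /=.
  have e2 : (2^-1 ^+ j : R) = 2 * 2^-1 ^+ j.+1 by rewrite exprS; field.
  have : 0 < 2^-1 ^+ j.+1 :> R by rewrite exprn_gt0 ?invr_gt0.
  move: (2^-1 ^+ j.+1 : R) e2 => v -> v0.
  have hp : v * (uphalf p)%:R <= v * (2 * p./2%:R).
    by rewrite ler_pM2l // -natrM ler_nat; lia.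
  have hq : v * q./2%:R <= v * (uphalf q)%:R.
    by rewrite ler_pM2l // ler_nat; lia.
  rewrite !ler_norml natrD -muln2 natrM => H; apply: (introT andP); move: H.
  by case: e => /= /andP[/andP[? ?] /andP[? ?]]; split; apply/andP; split; lra.
move=> /child_odd_dyadic[e ->]; rewrite near_even near_odd.
move: (mid K) => [x y] /=.
have e2 : (2^-1 ^+ j : R) = 2 * 2^-1 ^+ j.+1 by rewrite exprS; field.
have : 0 < 2^-1 ^+ j.+1 :> R by rewrite exprn_gt0 ?invr_gt0.
move: (2^-1 ^+ j.+1 : R) e2 => v -> v0.
have hp : v * p./2%:R <= v * (uphalf p)%:R.
  by rewrite ler_pM2l // ler_nat; lia.
have hq : v * (uphalf q)%:R <= v * (2 * q./2%:R).
  by rewrite ler_pM2l // -natrM ler_nat; lia.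
rewrite !ler_norml natrD -muln2 natrM => H; apply: (introT andP); move: H.
by case: e => /= /andP[/andP[? ?] /andP[? ?]]; split; apply/andP; split; lra.
Qed.

(** Midpoint differences of dyadic cells are integer multiples of a fixed unit, which turns nearness
    into integer arithmetic. *)
Lemma ler_norm_scaled_int (v : R) (z : int) (i : nat) : 0 < v ->
  (`|v * z%:~R| <= v * i%:R) = (`|z| <= i)%N.
Proof.
move=> v0; rewrite normrM gtr0_norm // ler_pM2l // -intr_norm -[i%:R]/(i%:~R).
by rewrite ler_int -abszE.
Qed.

Lemma near_even_odd j a b a' b' :
  near (dyadic j.*2 a' b') (dyadic j.*2.+1 a b) =
  (absz (4 * a'%:Z + 1 - 2 * a%:Z)%R <= (uphalf p).*2.+1)%N &&
  (absz (2 * b'%:Z - 2 * b%:Z)%R <= q./2.*2.+1)%N.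
Proof.
have e2 : (2^-1 ^+ j : R) = 2 * 2^-1 ^+ j.+1 by rewrite exprS; field.
have v0 : 0 < 2^-1 ^+ j.+1 :> R by rewrite exprn_gt0 ?invr_gt0.
rewrite -(@ler_norm_scaled_int (2^-1 ^+ j.+1 / 2)) ?divr_gt0 //.
rewrite -(@ler_norm_scaled_int (2^-1 ^+ j.+1)) // near_odd.
rewrite /mid /= uphalf_double doubleK e2.
rewrite -!natr1 -!muln2 !natrM !(rmorphB, rmorphD, rmorphM) /=.
by congr andb; congr (_ <= _); try (congr (`|_|)); field.
Qed.

Lemma near_odd_even j a b a' b' :
  near (dyadic j.*2.+1 a' b') (dyadic j.+1.*2 a b) =
  (absz (2 * a'%:Z - 2 * a%:Z)%R <= p./2.*2.+1)%N &&
  (absz (4 * b'%:Z + 1 - 2 * b%:Z)%R <= (uphalf q).*2.+1)%N.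
Proof.
have e2 : (2^-1 ^+ j : R) = 2 * 2^-1 ^+ j.+1 by rewrite exprS; field.
have v0 : 0 < 2^-1 ^+ j.+1 / 2 :> R by rewrite divr_gt0 ?exprn_gt0 ?invr_gt0.
rewrite -!(@ler_norm_scaled_int (2^-1 ^+ j.+1 / 2)) //.
rewrite near_even /mid /= uphalf_double !doubleK e2.
rewrite -!natr1 -!muln2 !natrM !(rmorphB, rmorphD, rmorphM) /=.
by congr andb; congr (_ <= _); try (congr (`|_|)); field.
Qed.

(* The triangle inequality alone is too weak by half a cell in one direction; *)
(* the parity of the integer midpoint differences recovers it.                *)
Lemma near_parents k E A c' c : is_dyadic k E -> is_dyadic k.+1 A ->
  c' \in child E -> c \in child A -> near c' c -> near E A.
Proof.
move=> [a' [b' ->]] [a [b ->]]; case: (parityP k) => j.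
  move=> /child_even_dyadic[e' ->] /child_odd_dyadic[e ->].
  by rewrite near_odd_even near_even_odd => /andP[? ?]; apply/andP; split; lia.
move=> /child_odd_dyadic[e' ->] /(@child_even_dyadic j.+1)[e ->].
rewrite (near_even_odd j.+1) (near_odd_even j) => /andP[? ?].
by apply/andP; split; lia.
Qed.

(* [B] collects the elements that have been bisected on the way to [G]. *)
Record history_invariant (G B : mesh R) : Prop := HistoryInvariant {
  history_dyadic : forall K, K \in G `|` B -> exists k, is_dyadic k K;
  history_parent : forall k K, K \in G `|` B -> is_dyadic k.+1 K ->
    exists2 A, A \in B & K \in child A;
  history_disjoint : forall K, K \in G -> K \notin B;
  history_far : forall A K, A \in B -> K \in G -> level K < level A ->
    ~~ near K A }.

(** * Preservation of the invariant under one bisection *)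

Section Invariant.
Variables G B : mesh R.
Hypothesis inv : history_invariant G B.

Lemma dyadic_parent k A c : is_dyadic k.+1 c ->
  A \in G `|` B -> c \in child A -> is_dyadic k A.
Proof.
move=> dc AGB cA; have [k' dA] := history_dyadic inv AGB.
by have [->] := is_dyadic_level_inj dc (dyadic_child dA cA).
Qed.

Lemma level_child A c : A \in G `|` B -> c \in child A ->
  level c = level A + 1.
Proof.
move=> /(history_dyadic inv)[k dA] cA.
by rewrite (level_dyadic dA) (level_dyadic (dyadic_child dA cA)) natr1.
Qed.

(** A recorded parent of [c] would have to be [E] by uniqueness of parents, yet [E] is still
    unbisected. *)
Lemma child_not_in E c : E \in G -> c \in child E -> c \notin G `|` B.
Proof.
move=> EG cE; have EGB : E \in G `|` B by rewrite inE EG.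
apply/negP => cGB; have [k dE] := history_dyadic inv EGB.
have [A AB cA] := history_parent inv cGB (dyadic_child dE cE).
have [|k' dA] := history_dyadic inv (K := A); first by rewrite inE AB orbT.
have AE := dyadic_parent_unique dA dE cA cE.
by have /negP := history_disjoint inv EG; rewrite -AE.
Qed.

(* Replacing [A] by its parent keeps [c'] near, until [A] is one level above  *)
(* [c']; then [near_parents] would put [E] itself near the parent of [A].     *)
Lemma child_far E c' A : E \in G -> c' \in child E -> A \in G `|` B ->
  level c' < level A -> ~~ near c' A.
Proof.
move=> EG c'E AGB; have EGB : E \in G `|` B by rewrite inE EG.
have [e dE] := history_dyadic inv EGB; have dc' := dyadic_child dE c'E.
have [a dA] := history_dyadic inv AGB.
rewrite (level_dyadic dc') (level_dyadic dA) ltr_nat.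
elim: a A AGB dA => // a IH A AGB dA le_ea; apply/negP => nc'A.
have [A' A'B AA'] := history_parent inv AGB dA.
have A'GB : A' \in G `|` B by rewrite inE A'B orbT.
have dA' := dyadic_parent dA A'GB AA'.
move: le_ea; rewrite ltnS leq_eqVlt => /orP[/eqP ea|lt_ea].
  move: dA'; rewrite -ea => dA'.
  have lEA' : level E < level A'.
    by rewrite (level_dyadic dE) (level_dyadic dA') ltr_nat.
  have /negP[] := history_far inv A'B EG lEA'.
  exact: near_parents dE dA' c'E AA' nc'A.
by have /negP[] := IH _ A'GB dA' lt_ea; exact: near_parent dA' AA' nc'A.
Qed.

(** Only [history_far] needs more than bookkeeping: for an old cell against [E] it is admissibility
    itself, against [B] it is inherited, and the new children are handled by [child_far]. *)
Lemma history_bisect1 E : admissible_bisect1 p q G E ->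
  history_invariant (bisect1 G E) (E |` B).
Proof.
move=> [EG admE]; have EGB : E \in G `|` B by rewrite inE EG.
have [e dE] := history_dyadic inv EGB.
have mem_cases K : K \in bisect1 G E `|` (E |` B) ->
    K \in G `|` B \/ K \in child E.
  rewrite !in_fsetU in_fsetD in_fset1.
  move=> /orP[/orP[/andP[_ ->]|->]|/orP[/eqP->|->]]; rewrite ?EG ?orbT; auto.
split.
- move=> K /mem_cases[/(history_dyadic inv)//|KE].
  by exists e.+1; exact: dyadic_child KE.
- move=> k K /mem_cases[KGB|KE] dK; last by exists E; rewrite // in_fset1U eqxx.
  have [A AB KA] := history_parent inv KGB dK.
  by exists A; rewrite // in_fset1U AB orbT.
- move=> K; rewrite in_fsetU in_fsetD in_fset1 in_fset1U.
  move=> /orP[/andP[/negPf-> KG]|KE].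
    by rewrite (history_disjoint inv KG).
  have := child_not_in EG KE; rewrite in_fsetU !negb_or => /andP[KG ->].
  by rewrite andbT; apply: contraNneq KG => ->.
- move=> A K; rewrite in_fset1U in_fsetU in_fsetD in_fset1.
  move=> AEB /orP[/andP[_ KG]|KE] lKA.
    case/orP: AEB lKA => [/eqP->|AB]; last by move=> /(history_far inv AB KG).
    by rewrite ltNge; apply: contraNN => nKE; apply: admE; rewrite !inE KG.
  apply: child_far EG KE _ lKA.
  by case/orP: AEB => [/eqP->//|AB]; rewrite inE AB orbT.
Qed.

(** A closed form depending only on the members of [s], so the order of bisection is immaterial. *)
Lemma mem_bisect_seq s K : {subset s <= G} ->
  (K \in bisect_seq G s) =
  ((K \in G) && (K \notin s)) || has (fun E => K \in child E) s.
Proof.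
elim/last_ind: s => [|s E IH] sG; first by rewrite andbT orbF.
have EG : E \in G by rewrite sG // mem_rcons mem_head.
have {}sG : {subset s <= G}.
  by move=> x xs; apply: sG; rewrite mem_rcons in_cons xs orbT.
rewrite /bisect_seq -cats1 foldl_cat /= -/(bisect_seq G s).
rewrite in_fsetU in_fsetD in_fset1 IH // mem_cat mem_seq1 has_cat has_seq1.
case: (eqVneq K E) => [->|_] /=; last by rewrite orbF orbA.
(* Removing [E] last must not erase a child created earlier: [E] lies in [G], so it is no child of a
   cell in [s]. *)
rewrite orbT andbF /= [has _ _](_ : _ = false) //.
apply/hasP => -[E' E's /(child_not_in (sG _ E's))].
by rewrite in_fsetU EG.
Qed.

End Invariant.

(** * Histories of admissible meshes *)

Lemma history_bisect_seq G B s : history_invariant G B ->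
  admissible_bisect_seq p q G s ->
  exists B', history_invariant (bisect_seq G s) B'.
Proof.
elim: s G B => [|E s IH] G B inv /=; first by exists B.
by move=> [admE adms]; exact: IH (history_bisect1 inv admE) adms.
Qed.

Lemma history_initial m n : history_invariant (initial_mesh R m n) fset0.
Proof.
have dyadic0 K : K \in initial_mesh R m n -> is_dyadic 0 K.
  move=> /imfset2P[i /= + [j /= + ->]]; rewrite !mem_iota => i0 j0.
  (* The indices start at 1, so the truncated predecessor is the true [i - 1]. *)
  exists i.-1, j.-1; rewrite /dyadic /= expr0 !mulr1.
  by congr Rect; rewrite -subn1 natrB //; lia.
split=> [K|k K|K|A K]; rewrite ?fsetU0 ?inE //.
- by move=> /dyadic0; exists 0%N.
- by move=> /dyadic0 d0 /(is_dyadic_level_inj d0).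
Qed.

Lemma history_admissible m n G : admissible_mesh p q m n G ->
  exists B, history_invariant G B.
Proof.
elim=> [|{}G M _ [B inv] _ [s [_ <- adms]]].
  by exists fset0; exact: history_initial.
exact: history_bisect_seq inv adms.
Qed.

(** * Bisecting a patch-closed set by increasing level *)

Lemma admissible_bisect_seqP G s :
  (forall s1 E s2, s = s1 ++ E :: s2 ->
     admissible_bisect1 p q (bisect_seq G s1) E) ->
  admissible_bisect_seq p q G s.
Proof.
elim: s G => //= E s IH G adm; split; first exact: (adm [::] E s).
by apply: IH => s1 E' s2 es; apply: (adm (E :: s1) E' s2); rewrite es.
Qed.

Lemma clos_closed G M : patch_closed p q G (clos p q G M).
Proof.
move=> K; rewrite !inE => /andP[KG /asboolP closK] K' K'p lK'.
have K'G : K' \in G by move: K'p; rewrite !inE => /andP[].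
rewrite !inE K'G; apply/asboolP => M' MM' M'G closM'.
exact: closM' (closK _ MM' M'G closM') _ K'p lK'.
Qed.

Lemma bisect_patch_closed G B C : history_invariant G B -> C `<=` G ->
  patch_closed p q G C -> admissible_bisect p q G C.
Proof.
move=> inv CG closC; pose r : rel (rect R) := fun K K' => level K <= level K'.
exists (sort r (enum_fset C)).
have mems K : (K \in sort r (enum_fset C)) = (K \in C) by rewrite mem_sort.
have : perm_eq (sort r (enum_fset C)) (enum_fset C) by rewrite perm_sort.
have : sorted r (sort r (enum_fset C)).
  by apply: sort_sorted => K K'; exact: le_total.
have : uniq (sort r (enum_fset C)) by rewrite sort_uniq fset_uniq.
move: (sort _ _) mems => s mems us srt pms.
have sG : {subset s <= G} by move=> K; rewrite mems; exact: fsubsetP CG K.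
split=> //.
  (* Only membership in the list matters, hence sorting does not change the resulting mesh. *)
  apply/fsetP => K; rewrite /bisect !(mem_bisect_seq inv) //; last first.
    by move=> x; exact: fsubsetP CG x.
  by rewrite mems (perm_has _ pms).
(* Each intermediate mesh is described from [G] by [mem_bisect_seq], so the invariant of the
   original [G] suffices throughout. *)
apply: admissible_bisect_seqP => s1 E s2 es.
have Es : E \in s by rewrite es mem_cat mem_head orbT.
have s1G : {subset s1 <= G} by move=> K Ks1; apply: sG; rewrite es mem_cat Ks1.
move: us; rewrite es cat_uniq /= negb_or => /and3P[_ /andP[Es1 _] _].
split=> [|K]; first by rewrite (mem_bisect_seq inv) // sG // Es1.
rewrite !inE => /andP[+ nKE]; rewrite (mem_bisect_seq inv) //.
rewrite leNgt => KG; apply/negP => lKE.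
case/orP: KG => [/andP[KG Ks1]|/hasP[E' E's1 KE']].
  (* A coarser unbisected neighbour belongs to [C] by closedness, and sorting would have placed it
     in [s1]. *)
  have : K \in s by rewrite mems; apply: closC lKE; rewrite -?mems // !inE KG.
  rewrite es mem_cat (negPf Ks1) in_cons /= => /orP[/eqP KE|Ks2].
    by move: lKE; rewrite KE ltxx.
  move: srt; rewrite es sorted_cat_cons => /andP[_].
  rewrite path_sortedE => [/andP[/allP/(_ _ Ks2)]|]; last first.
    by move=> ? ? ?; exact: le_trans.
  by rewrite /r leNgt lKE.
(* A coarser neighbour created by bisecting [E'] is excluded by [child_far], applied in the original
   mesh. *)
have EGB : E \in G `|` B by rewrite inE sG.
by have /negP[] := child_far inv (s1G _ E's1) KE' EGB lKE.
Qed.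

End Dyadic.

Theorem proposition2p13 (R : realType) (p q m n : nat)
  (p_ge2 : (2 <= p)%N) (q_ge2 : (2 <= q)%N) (m_gt0 : (0 < m)%N) (n_gt0 : (0 < n)%N)
  (G M : mesh R) (admG : admissible_mesh p q m n G) (MG : (M `<=` G)%fset) :
  admissible_mesh p q m n (refine p q G M).
Proof.
have [B inv] := history_admissible p_ge2 q_ge2 admG.
have closG : clos p q G M `<=` G by exact: fset_sub.
apply: admissible_step => //.
exact: bisect_patch_closed inv closG (@clos_closed _ p q G M).
Qed.
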